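(* Let $\alpha>0$ be a constant and let $n\ge2$. The function $$p^\alpha_{\mathbb{H}^n}(x,y)=\frac{|x-y|}{\sqrt{|x-y|^2+\alpha x_ny_n}},\quad x=(x_1,\dots,x_n),\ y=(y_1,\dots,y_n)\in\mathbb{H}^n,$$ is a metric on $\mathbb{H}^n$ if and only if $\alpha\le12$.
   Context: $\mathbb{H}^n=\{x=(x_1,\dots,x_n)\in\mathbb{R}^n : x_n>0\}$ is the upper half-space and $|\cdot|$ denotes the Euclidean norm on $\mathbb{R}^n$. *)

(* Defs.v *)
From mathcomp Require Import all_boot all_order all_algebra.
From mathcomp Require Import boolp classical_sets reals.
Set Implicit Arguments.
Unset Strict Implicit.
Unset Printing Implicit Defensive.
Import Order.TTheory GRing.Theory Num.Theory.
Local Open Scope ring_scope.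
Local Open Scope classical_set_scope.

(* The norm MathComp-Analysis puts on row vectors is the sup norm, hence this
   separate definition of the Euclidean norm. *)
Definition enorm (R : realType) (n : nat) (x : 'rV[R]_n) : R :=
  Num.sqrt (\sum_(i < n) x ord0 i ^+ 2).

(* The dimension is written n.+1 so that the last coordinate, x_n in the usual
   1-based notation, is x ord0 ord_max. *)
Definition last_coord (R : realType) (n : nat) (x : 'rV[R]_n.+1) : R :=
  x ord0 ord_max.

Definition upper_half_space (R : realType) (n : nat) : set 'rV[R]_n.+1 :=
  [set x | 0 < last_coord x].

Definition p_alpha (R : realType) (n : nat) (alpha : R) (x y : 'rV[R]_n.+1) : R :=
  enorm (x - y) /
  Num.sqrt (enorm (x - y) ^+ 2 + alpha * last_coord x * last_coord y).

Definition is_metric_on (R : realType) (T : Type) (A : set T) (d : T -> T -> R)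
    : Prop :=
  [/\ forall x y, A x -> A y -> 0 <= d x y,
      forall x y, A x -> A y -> (d x y = 0 <-> x = y),
      forall x y, A x -> A y -> d x y = d y x
    & forall x y z, A x -> A y -> A z -> d x z <= d x y + d y z].

(* Main.v *)
(** With [rho] the hyperbolic distance, [p_alpha x y = u / sqrt (u^2 + alpha)]
    where [u = |x - y| / sqrt (x_n y_n) = 2 sinh (rho / 2)].  The triangle
    inequality for [rho], in the form [2 u(x,z) <= u(x,y) sqrt (u(y,z)^2 + 4) +
    u(y,z) sqrt (u(x,y)^2 + 4)], is Ptolemy's inequality for [x], [y], [z] and
    the mirror image of [y].  As a function of [rho], [p_alpha] is concave
    exactly when [alpha <= 12]; instead of derivatives, its subadditivity is
    obtained from an algebraic inequality between the two summands.  For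
    [alpha > 12] it is strictly convex near [0], so that three nearby points of
    a vertical geodesic violate the triangle inequality. *)
Require Import Defs.
From mathcomp Require Import all_boot all_order all_algebra.
From mathcomp Require Import boolp classical_sets reals.
From mathcomp Require Import ring lra.
Set Implicit Arguments.
Unset Strict Implicit.
Unset Printing Implicit Defensive.
Import Order.TTheory GRing.Theory Num.Theory.
Local Open Scope ring_scope.
Local Open Scope classical_set_scope.

(** * Euclidean inner product and norm *)

Definition edot {R : realType} {n : nat} (u v : 'rV[R]_n) : R :=
  \sum_(i < n) u ord0 i * v ord0 i.

Lemma edotC (R : realType) (n : nat) (u v : 'rV[R]_n) : edot u v = edot v u.
Proof. by apply: eq_bigr => i _; rewrite mulrC. Qed.

Lemma edotDl (R : realType) (n : nat) (u v w : 'rV[R]_n) :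
  edot (u + v) w = edot u w + edot v w.
Proof. by rewrite -big_split; apply: eq_bigr => i _; rewrite mxE mulrDl. Qed.

Lemma edotZl (R : realType) (n : nat) (a : R) (u v : 'rV[R]_n) :
  edot (a *: u) v = a * edot u v.
Proof. by rewrite mulr_sumr; apply: eq_bigr => i _; rewrite mxE mulrA. Qed.

Lemma edotNl (R : realType) (n : nat) (u v : 'rV[R]_n) :
  edot (- u) v = - edot u v.
Proof. by rewrite -scaleN1r edotZl mulN1r. Qed.

Lemma edotDr (R : realType) (n : nat) (u v w : 'rV[R]_n) :
  edot u (v + w) = edot u v + edot u w.
Proof. by rewrite edotC edotDl !(edotC _ u). Qed.

Lemma edotZr (R : realType) (n : nat) (a : R) (u v : 'rV[R]_n) :
  edot u (a *: v) = a * edot u v.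
Proof. by rewrite edotC edotZl edotC. Qed.

Lemma edotNr (R : realType) (n : nat) (u v : 'rV[R]_n) :
  edot u (- v) = - edot u v.
Proof. by rewrite edotC edotNl edotC. Qed.

Definition edotE := (edotDl, edotDr, edotNl, edotNr, edotZl, edotZr).

Lemma edot_ge0 (R : realType) (n : nat) (u : 'rV[R]_n) : 0 <= edot u u.
Proof. by apply: sumr_ge0 => i _; rewrite -expr2 sqr_ge0. Qed.

Lemma edot_eq0 (R : realType) (n : nat) (u : 'rV[R]_n) :
  edot u u = 0 -> u = 0.
Proof.
move=> /eqP; rewrite psumr_eq0 => [/allP u0|i _]; last by rewrite -expr2 sqr_ge0.
apply/rowP => i; rewrite mxE; apply/eqP.
by have := u0 i (mem_index_enum i); rewrite mulf_eq0 orbb.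
Qed.

Lemma enormE (R : realType) (n : nat) (u : 'rV[R]_n) :
  enorm u = Num.sqrt (edot u u).
Proof. by []. Qed.

Lemma enorm_sqr (R : realType) (n : nat) (u : 'rV[R]_n) :
  enorm u ^+ 2 = edot u u.
Proof. by rewrite enormE sqr_sqrtr ?edot_ge0. Qed.

Lemma enorm_ge0 (R : realType) (n : nat) (u : 'rV[R]_n) : 0 <= enorm u.
Proof. exact: sqrtr_ge0. Qed.

Lemma enorm_eq0 (R : realType) (n : nat) (u : 'rV[R]_n) :
  enorm u = 0 -> u = 0.
Proof. by move=> u0; apply: edot_eq0; rewrite -enorm_sqr u0 expr0n. Qed.

Lemma enorm0 (R : realType) (n : nat) : enorm (0 : 'rV[R]_n) = 0.
Proof.
by rewrite enormE -(scale0r 0) edotZl mul0r sqrtr0.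
Qed.

Lemma enormZ (R : realType) (n : nat) (a : R) (u : 'rV[R]_n) :
  enorm (a *: u) = `|a| * enorm u.
Proof. by rewrite !enormE !edotE mulrA -expr2 sqrtrM ?sqr_ge0// sqrtr_sqr. Qed.

Lemma enormB (R : realType) (n : nat) (u v : 'rV[R]_n) :
  enorm (u - v) = enorm (v - u).
Proof. by rewrite -opprB -scaleN1r enormZ normrN1 mul1r. Qed.

Lemma edot_le_enorm (R : realType) (n : nat) (u v : 'rV[R]_n) :
  edot u v <= enorm u * enorm v.
Proof.
have [->|u0] := eqVneq u 0.
  by rewrite -(scale0r 0) edotZl mul0r mulr_ge0 ?enorm_ge0.
have uu_gt0 : 0 < edot u u.
  by rewrite lt_neqAle edot_ge0 andbT; apply: contra_neq u0 => /esym/edot_eq0.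
apply: le_trans (ler_norm _) _; rewrite -sqrtr_sqr !enormE -sqrtrM ?edot_ge0//.
rewrite ler_wsqrtr//.
(* Up to the factor [edot u u], this vector is the component of [v] orthogonal to [u]. *)
have := edot_ge0 (edot u u *: v - edot u v *: u).
rewrite !edotE (edotC v u).
set A := edot u u in uu_gt0 *; set B := edot v v; set C := edot u v => h.
rewrite -(ler_pM2l uu_gt0); nra.
Qed.

Lemma enorm_triangle (R : realType) (n : nat) (u v : 'rV[R]_n) :
  enorm (u + v) <= enorm u + enorm v.
Proof.
rewrite -(@ler_pXn2r _ 2) ?nnegrE ?addr_ge0 ?enorm_ge0//.
rewrite sqrrD !enorm_sqr !edotE (edotC v u).
by have := edot_le_enorm u v; lra.
Qed.

(** * Inversion and Ptolemy's inequality *)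

(** For nonzero [p], [q] this is the distance between the inverted points p/|p|^2 and q/|q|^2,
    cleared of denominators by the factor |p|^2 |q|^2. *)
Lemma enorm_inversion (R : realType) (n : nat) (p q : 'rV[R]_n) :
  enorm (enorm q ^+ 2 *: p - enorm p ^+ 2 *: q) =
  enorm p * enorm q * enorm (p - q).
Proof.
apply/eqP; rewrite -(@eqrXn2 _ 2) ?mulr_ge0 ?enorm_ge0//; apply/eqP.
rewrite !exprMn !enorm_sqr !edotE (edotC q p); ring.
Qed.

(* Multiplied by [|p| |q| |r|], this is the triangle inequality for the images
   of [p], [q], [r] under the inversion in the unit sphere. *)
Lemma ptolemy0 (R : realType) (n : nat) (p q r : 'rV[R]_n) :
  enorm (p - q) * enorm r <= enorm p * enorm (q - r) + enorm q * enorm (p - r).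
Proof.
have [->|p0] := eqVneq p 0.
  by rewrite !sub0r -scaleN1r -(scaleN1r r) !enormZ !enorm0 !normrN1; lra.
have [->|q0] := eqVneq q 0.
  by rewrite !sub0r !subr0 -(scaleN1r r) !enormZ !enorm0 !normrN1; lra.
have [->|r0] := eqVneq r 0.
  by rewrite enorm0 mulr0 addr_ge0 ?mulr_ge0 ?enorm_ge0.
have gt0 (u : 'rV[R]_n) : u != 0 -> 0 < enorm u.
  move=> u0; rewrite lt_neqAle enorm_ge0 andbT.
  by apply: contra_neq u0 => /esym/enorm_eq0.
have [[Np Nq] Nr] := (gt0 _ p0, gt0 _ q0, gt0 _ r0).
have := enorm_triangle
  (enorm q ^+ 2 *: (enorm r ^+ 2 *: p - enorm p ^+ 2 *: r))
  (enorm p ^+ 2 *: (enorm q ^+ 2 *: r - enorm r ^+ 2 *: q)).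
have -> : enorm q ^+ 2 *: (enorm r ^+ 2 *: p - enorm p ^+ 2 *: r) +
  enorm p ^+ 2 *: (enorm q ^+ 2 *: r - enorm r ^+ 2 *: q) =
  enorm r ^+ 2 *: (enorm q ^+ 2 *: p - enorm p ^+ 2 *: q).
  by apply/rowP => i; rewrite !mxE; ring.
rewrite !(enormZ _ (_ - _)) !enorm_inversion !ger0_norm ?exprn_ge0 ?enorm_ge0//.
rewrite (enormB r q) => h.
rewrite -(ler_pM2l (mulr_gt0 Np (mulr_gt0 Nq Nr))); nra.
Qed.

Lemma ptolemy (R : realType) (n : nat) (x y z w : 'rV[R]_n) :
  enorm (x - z) * enorm (y - w) <=
  enorm (x - y) * enorm (z - w) + enorm (y - z) * enorm (x - w).
Proof.
have := ptolemy0 (x - y) (z - y) (w - y).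
have sub3 (a b c : 'rV[R]_n) : a - c - (b - c) = a - b.
  by rewrite opprB addrA subrK.
by rewrite !sub3 (enormB w y) (enormB z y).
Qed.

(** * Mirror images in the boundary and the hyperbolic sine *)

Definition basis_last (R : realType) (n : nat) : 'rV[R]_n.+1 :=
  delta_mx ord0 ord_max.

Lemma edot_basis_last (R : realType) (n : nat) (u : 'rV[R]_n.+1) :
  edot u (basis_last R n) = last_coord u.
Proof.
rewrite /edot (bigD1 ord_max)//= big1 => [|i ni]; rewrite !mxE ?eqxx/=.
  by rewrite mulr1 addr0.
by rewrite (negbTE ni) mulr0.
Qed.

Lemma last_basis_last (R : realType) (n : nat) :
  last_coord (basis_last R n) = 1.
Proof. by rewrite /last_coord mxE !eqxx. Qed.

Lemma last_coordZ (R : realType) (n : nat) (a : R) (u : 'rV[R]_n.+1) :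
  last_coord (a *: u) = a * last_coord u.
Proof. by rewrite /last_coord mxE. Qed.

Lemma enorm_basis_last (R : realType) (n : nat) : enorm (basis_last R n) = 1.
Proof. by rewrite enormE edot_basis_last last_basis_last sqrtr1. Qed.

Definition reflect_last {R : realType} {n : nat} (y : 'rV[R]_n.+1) :=
  y - (2 * last_coord y) *: basis_last R n.

(** Reflection turns (x_n - y_n)^2 into (x_n + y_n)^2, a gain of 4 x_n y_n. *)
Lemma enorm_sub_reflect_last (R : realType) (n : nat) (x y : 'rV[R]_n.+1) :
  enorm (x - reflect_last y) =
  Num.sqrt (enorm (x - y) ^+ 2 + 4 * last_coord x * last_coord y).
Proof.
rewrite enorm_sqr enormE; congr Num.sqrt.
rewrite /reflect_last !edotE !edot_basis_last !(edotC (basis_last R n)).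
rewrite !edot_basis_last last_basis_last (edotC y x); ring.
Qed.

(* Twice the hyperbolic sine of half the hyperbolic distance. *)
Definition hyp_sinh {R : realType} {n : nat} (x y : 'rV[R]_n.+1) : R :=
  enorm (x - y) / Num.sqrt (last_coord x * last_coord y).

Lemma hyp_sinh_ge0 (R : realType) (n : nat) (x y : 'rV[R]_n.+1) :
  0 <= hyp_sinh x y.
Proof. by rewrite divr_ge0 ?enorm_ge0 ?sqrtr_ge0. Qed.

(** Serves twice: [c = alpha] gives the denominator of [p_alpha], [c = 4] the distance to a mirror
    image. *)
Lemma sqrt_hyp_sinh (R : realType) (n : nat) (c : R) (x y : 'rV[R]_n.+1) :
  0 < last_coord x -> 0 < last_coord y ->
  Num.sqrt (enorm (x - y) ^+ 2 + c * last_coord x * last_coord y) =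
  Num.sqrt (last_coord x * last_coord y) * Num.sqrt (hyp_sinh x y ^+ 2 + c).
Proof.
move=> x0 y0; rewrite -sqrtrM ?mulr_ge0 ?ltW//; congr Num.sqrt.
have xy0 : 0 < last_coord x * last_coord y by rewrite mulr_gt0.
rewrite /hyp_sinh expr_div_n (sqr_sqrtr (ltW xy0)).
by field; rewrite !gt_eqF.
Qed.

Lemma p_alphaE (R : realType) (n : nat) (alpha : R) (x y : 'rV[R]_n.+1) :
  0 < last_coord x -> 0 < last_coord y ->
  p_alpha alpha x y = hyp_sinh x y / Num.sqrt (hyp_sinh x y ^+ 2 + alpha).
Proof.
move=> x0 y0; rewrite /p_alpha sqrt_hyp_sinh// invfM.
by rewrite {2}/hyp_sinh mulrA.
Qed.

(* Ptolemy's inequality for [x], [z], [y] and the mirror image of [y]; the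
   bound is the addition formula for the hyperbolic sine. *)
Lemma hyp_sinh_triangle (R : realType) (n : nat) (x y z : 'rV[R]_n.+1) :
  0 < last_coord x -> 0 < last_coord y -> 0 < last_coord z ->
  2 * hyp_sinh x z <=
  hyp_sinh x y * Num.sqrt (hyp_sinh y z ^+ 2 + 4) +
  hyp_sinh y z * Num.sqrt (hyp_sinh x y ^+ 2 + 4).
Proof.
move=> x0 y0 z0; have := ptolemy x y z (reflect_last y).
have -> : enorm (y - reflect_last y) = 2 * last_coord y.
  rewrite /reflect_last opprB addrC subrK enormZ enorm_basis_last mulr1.
  by rewrite gtr0_norm// mulr_gt0.
rewrite !enorm_sub_reflect_last !sqrt_hyp_sinh//.
have enormE2 (u v : 'rV[R]_n.+1) : 0 < last_coord u -> 0 < last_coord v ->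
    enorm (u - v) =
    hyp_sinh u v * (Num.sqrt (last_coord u) * Num.sqrt (last_coord v)).
  move=> u0 v0; rewrite -sqrtrM ?ltW// /hyp_sinh divfK//.
  by rewrite gt_eqF// sqrtr_gt0 mulr_gt0.
have -> : hyp_sinh z y = hyp_sinh y z.
  by rewrite /hyp_sinh enormB [last_coord z * _]mulrC.
rewrite !enormE2// !(sqrtrM _ (ltW x0)) !(sqrtrM _ (ltW z0)).
have := sqr_sqrtr (ltW y0).
move: x0 y0 z0; rewrite -(sqrtr_gt0 (last_coord x)) -(sqrtr_gt0 (last_coord y)).
rewrite -(sqrtr_gt0 (last_coord z)).
move: (Num.sqrt (last_coord x)) (Num.sqrt (last_coord y))
  (Num.sqrt (last_coord z)) => a b c a0 b0 c0 <- h.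
(* In the square roots [a], [b], [c] of the heights, every term of Ptolemy's inequality carries the
   factor a c b^2. *)
rewrite -(ler_pM2l (mulr_gt0 (mulr_gt0 a0 c0) (mulr_gt0 b0 b0))).
nra.
Qed.

(** * Subadditivity for alpha <= 12 *)

(* With [X], [Y] the two terms on the right, concavity of the square root bounds
   [c], and what remains is
   [(1 + 2 X Y) (1 - (X + Y)^2) <= (1 - X^2) (1 - Y^2)]. *)
Lemma subadditive_div_sqrt (R : realType) (alpha a b c : R) :
  0 < alpha -> alpha <= 12 -> 0 <= a -> 0 <= b -> 0 <= c ->
  2 * c <= a * Num.sqrt (b ^+ 2 + 4) + b * Num.sqrt (a ^+ 2 + 4) ->
  c / Num.sqrt (c ^+ 2 + alpha) <=
  a / Num.sqrt (a ^+ 2 + alpha) + b / Num.sqrt (b ^+ 2 + alpha).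
Proof.
move=> alpha0 ale a0 b0 c0 cle.
have den_gt0 (u : R) : 0 < Num.sqrt (u ^+ 2 + alpha).
  by rewrite sqrtr_gt0 ltr_wpDl ?sqr_ge0.
have den_sqr (u : R) : Num.sqrt (u ^+ 2 + alpha) ^+ 2 = u ^+ 2 + alpha.
  by rewrite sqr_sqrtr// addr_ge0 ?sqr_ge0// ltW.
have sqr4 (u : R) : Num.sqrt (u ^+ 2 + 4) ^+ 2 = u ^+ 2 + 4.
  by rewrite sqr_sqrtr// addr_ge0 ?sqr_ge0.
rewrite ler_pdivrMr//.
have c_le : c <= Num.sqrt (c ^+ 2 + alpha).
  by rewrite -(@ler_pXn2r _ 2) ?nnegrE ?sqrtr_ge0// den_sqr lerDl ltW.
have := den_gt0 a; have := den_gt0 b; have := den_sqr a; have := den_sqr b.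
have := sqr4 a; have := sqr4 b; move: cle.
set A := Num.sqrt (a ^+ 2 + 4); set B := Num.sqrt (b ^+ 2 + 4).
set D := Num.sqrt (a ^+ 2 + _); set E := Num.sqrt (b ^+ 2 + _).
move=> cle B2 A2 E2 D2 E0 D0.
set X := a / D; set Y := b / E.
have X0 : 0 <= X by rewrite divr_ge0// ltW.
have Y0 : 0 <= Y by rewrite divr_ge0// ltW.
have aE : a = X * D by rewrite /X divfK// gt_eqF.
have bE : b = Y * E by rewrite /Y divfK// gt_eqF.
(* The left-hand quotient is at most 1, so only X + Y < 1 needs work. *)
clearbody X Y; have [S1|S1] := leP 1 (X + Y).
  by rewrite (le_trans c_le)// ler_peMl// ltW.
have alphaX : D ^+ 2 * (1 - X ^+ 2) = alpha.
  by move: D2; rewrite {1}aE => D2; lra.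
have alphaY : E ^+ 2 * (1 - Y ^+ 2) = alpha.
  by move: E2; rewrite {1}bE => E2; lra.
set M := (1 - X ^+ 2) * (1 - Y ^+ 2).
have X1 : 0 < 1 - X ^+ 2 by nra.
have Y1 : 0 < 1 - Y ^+ 2 by nra.
have M0 : 0 < M by apply: mulr_gt0.
rewrite -(@ler_pXn2r _ 2) ?nnegrE ?mulr_ge0 ?addr_ge0 ?sqrtr_ge0//.
rewrite exprMn den_sqr.
(* Convexity of the square with weights [X], [Y]: the defect is X Y (D B - E A)^2. *)
have jensen : (2 * c) ^+ 2 <=
    (X + Y) * (X * (D ^+ 2 * B ^+ 2) + Y * (E ^+ 2 * A ^+ 2)).
  have h : (2 * c) ^+ 2 <= (X * (D * B) + Y * (E * A)) ^+ 2.
    rewrite ler_pXn2r ?nnegrE ?addr_ge0 ?mulr_ge0 ?sqrtr_ge0//.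
    by rewrite !mulrA -aE -bE.
  apply: le_trans h _.
  by have := mulr_ge0 (mulr_ge0 X0 Y0) (sqr_ge0 (D * B - E * A)); lra.
(* Here and in [boundEA] the hypothesis alpha <= 12 enters, as alpha - 4 <= 8. *)
have boundDB : M * (D ^+ 2 * B ^+ 2) <= 4 * alpha * (1 + 2 * Y ^+ 2).
  have -> : M * (D ^+ 2 * B ^+ 2) = alpha * (4 + (alpha - 4) * Y ^+ 2).
    have -> : M * (D ^+ 2 * B ^+ 2) = D ^+ 2 * (1 - X ^+ 2) *
        (Y ^+ 2 * (E ^+ 2 * (1 - Y ^+ 2)) + 4 * (1 - Y ^+ 2)).
      by rewrite B2 bE /M; ring.
    by rewrite alphaX alphaY; ring.
  have := mulr_ge0 (ltW alpha0) (mulr_ge0 (sqr_ge0 Y) (_ : 0 <= 12 - alpha)).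
  by rewrite subr_ge0 => /(_ ale); lra.
have boundEA : M * (E ^+ 2 * A ^+ 2) <= 4 * alpha * (1 + 2 * X ^+ 2).
  have -> : M * (E ^+ 2 * A ^+ 2) = alpha * (4 + (alpha - 4) * X ^+ 2).
    have -> : M * (E ^+ 2 * A ^+ 2) = E ^+ 2 * (1 - Y ^+ 2) *
        (X ^+ 2 * (D ^+ 2 * (1 - X ^+ 2)) + 4 * (1 - X ^+ 2)).
      by rewrite A2 aE /M; ring.
    by rewrite alphaY alphaX; ring.
  have := mulr_ge0 (ltW alpha0) (mulr_ge0 (sqr_ge0 X) (_ : 0 <= 12 - alpha)).
  by rewrite subr_ge0 => /(_ ale); lra.
(* The weighted bounds add up by X (1 + 2 Y^2) + Y (1 + 2 X^2) = (X + Y) (1 + 2 X Y). *)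
have Mc : M * c ^+ 2 <= alpha * (X + Y) ^+ 2 * (1 + 2 * (X * Y)).
  have := ler_wpM2l (ltW M0) jensen.
  have := ler_wpM2l (mulr_ge0 (addr_ge0 X0 Y0) X0) boundDB.
  have := ler_wpM2l (mulr_ge0 (addr_ge0 X0 Y0) Y0) boundEA.
  lra.
(* The difference of the two sides is (X Y)^2 + 2 X Y (X + Y)^2. *)
have key : (1 + 2 * (X * Y)) * (1 - (X + Y) ^+ 2) <= M.
  have := mulr_ge0 (mulr_ge0 X0 Y0) (sqr_ge0 (X + Y)).
  have := sqr_ge0 (X * Y); rewrite /M; lra.
have S2 : 0 <= 1 - (X + Y) ^+ 2 by nra.
rewrite -(ler_pM2l M0).
have := ler_wpM2r S2 Mc.
have := ler_wpM2l (mulr_ge0 (ltW alpha0) (sqr_ge0 (X + Y))) key.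
lra.
Qed.

(** * Necessity of alpha <= 12, on a vertical line *)

Lemma p_alpha_vertical (R : realType) (n : nat) (alpha s t : R) :
  p_alpha alpha (s *: basis_last R n) (t *: basis_last R n) =
  `|s - t| / Num.sqrt ((s - t) ^+ 2 + alpha * s * t).
Proof.
rewrite /p_alpha -scalerBl enormZ enorm_basis_last mulr1 real_normK ?num_real//.
by rewrite !last_coordZ last_basis_last !mulr1.
Qed.

(* The triangle inequality for the heights [1], [t], [t^2] on a vertical line
   reads [alpha t <= 3 (t + 1)^2], which tends to [alpha <= 12] as [t] tends
   to 1. *)
Lemma metric_alpha_le (R : realType) (n : nat) (alpha : R) :
  0 < alpha -> is_metric_on (@upper_half_space R n) (@p_alpha R n alpha) ->
  alpha <= 12.
Proof.
move=> alpha0 [_ _ _ tri].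
have bound (t : R) : 1 < t -> alpha * t <= 3 * (t + 1) ^+ 2.
  move=> t1; have t0 : 0 < t by lra.
  have pos (s : R) : 0 < s -> upper_half_space (s *: basis_last R n).
    by move=> s0; rewrite /upper_half_space/= last_coordZ last_basis_last mulr1.
  have := tri _ _ _ (pos _ ltr01) (pos _ t0) (pos _ (exprn_gt0 2 t0)).
  rewrite !p_alpha_vertical.
  (* The pair t, t^2 is the pair 1, t scaled by [t]; by scale invariance both summands on the right
     are equal. *)
  have -> : (t - t ^+ 2) ^+ 2 + alpha * t * t ^+ 2 =
      t ^+ 2 * ((1 - t) ^+ 2 + alpha * 1 * t) by ring.
  have -> : t - t ^+ 2 = t * (1 - t) by ring.
  have -> : 1 - t ^+ 2 = (1 + t) * (1 - t) by ring.
  rewrite sqrtrM ?sqr_ge0// sqrtr_sqr !normrM (gtr0_norm t0).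
  rewrite (@gtr0_norm _ (1 + t)); last by lra.
  rewrite -mulf_div divff ?gt_eqF// mul1r -mulr2n -(mulr_natl (_ / _) 2).
  have d0 : 0 < `|1 - t| by rewrite normr_gt0 subr_eq0 lt_eqF.
  set U := Num.sqrt ((1 - t) ^+ 2 + _); set V := Num.sqrt _.
  have U2pos : 0 < (1 - t) ^+ 2 + alpha * 1 * t.
    by rewrite mulr1 ltr_wpDl ?sqr_ge0 ?mulr_gt0.
  have V2pos : 0 < ((1 + t) * (1 - t)) ^+ 2 + alpha * 1 * t ^+ 2.
    by rewrite mulr1 ltr_wpDl ?sqr_ge0 ?mulr_gt0 ?exprn_gt0.
  have U0 : 0 < U by rewrite sqrtr_gt0.
  have V0 : 0 < V by rewrite sqrtr_gt0.
  rewrite mulrAC [2 * _]mulrA [2 * _ / _]mulrAC ler_pM2r//.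
  rewrite ler_pdivrMr// mulrAC ler_pdivlMr//.
  move=> h; have : ((1 + t) * U) ^+ 2 <= (2 * V) ^+ 2.
    by apply: lerXn2r h; rewrite nnegrE mulr_ge0 //; lra.
  rewrite !exprMn (sqr_sqrtr (ltW U2pos)) (sqr_sqrtr (ltW V2pos)) => {}h.
  (* Since (1 + t)^2 - 4 t = (1 - t)^2, the factor (1 - t)^2 cancels throughout. *)
  have e2 : 0 < (1 - t) ^+ 2 by rewrite exprn_even_gt0//= subr_eq0 lt_eqF.
  rewrite -(ler_pM2l e2); lra.
rewrite leNgt; apply/negP => a12.
set d := alpha - 12; have d0 : 0 < d by rewrite subr_gt0.
have d1 : 0 < 1 + d by lra.
(* At t = 1 + e the bound reads d + d e <= 3 e^2, so 3 e^2 < d refutes it; for this [e] that means 3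
   d < (1 + d)^2, true for every d. *)
set e := d / (1 + d); have e0 : 0 < e by rewrite divr_gt0.
have eE : e * (1 + d) = d by rewrite divfK// gt_eqF.
have e1 : 3 * e ^+ 2 < d.
  rewrite -(ltr_pM2r (exprn_gt0 2 d1)) -mulrA -exprMn eE; nra.
have := bound (1 + e); rewrite ltrDl => /(_ e0).
have -> : alpha = 12 + d by rewrite addrC subrK.
have := mulr_gt0 d0 e0; lra.
Qed.

Theorem theorem5p13 (R : realType) (n : nat) (alpha : R)
    (hn : (2 <= n.+1)%N) (halpha : 0 < alpha) :
  is_metric_on (@upper_half_space R n) (@p_alpha R n alpha) <-> alpha <= 12%:R.
Proof.
split=> [|ale]; first exact: metric_alpha_le.
have den_gt0 (u : R) : 0 < Num.sqrt (u ^+ 2 + alpha).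
  by rewrite sqrtr_gt0 ltr_wpDl ?sqr_ge0.
split=> [x y x0 y0|x y x0 y0|x y x0 y0|x y z x0 y0 z0].
- by rewrite p_alphaE// divr_ge0 ?hyp_sinh_ge0 ?sqrtr_ge0.
- split=> [/eqP|->]; last by rewrite /p_alpha subrr enorm0 mul0r.
  have xy0 : 0 < Num.sqrt (last_coord x * last_coord y).
    by rewrite sqrtr_gt0 mulr_gt0.
  rewrite p_alphaE// /hyp_sinh !mulf_eq0 !invr_eq0 (gt_eqF (den_gt0 _)).
  rewrite (gt_eqF xy0) !orbF => /eqP/enorm_eq0/eqP.
  by rewrite subr_eq0 => /eqP.
- by rewrite /p_alpha enormB mulrAC.
- rewrite !p_alphaE//; apply: subadditive_div_sqrt; rewrite ?hyp_sinh_ge0//.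
  exact: hyp_sinh_triangle.
Qed.
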